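(* Let $\alpha^{\mathrm{FJ}}_k\in(0,1)$ be the Frieze--Jerrum approximation ratio for Max-$k$-Cut, and define the explicit degree threshold $$d_k^{\star} := \frac{4\,(\alpha^{\mathrm{FJ}}_k)^2}{(1-\alpha^{\mathrm{FJ}}_k)^2}.$$ Then for every $d$-regular graph $G=(V,E)$ whose adjacency matrix $A_G$ satisfies the near-Ramanujan bound $\lambda_{\min}(A_G)\ge -2\sqrt{d-1}$ (which holds asymptotically almost surely for random $d$-regular graphs by Friedman's theorem), and for every degree $d>d_k^{\star}$, the cut fraction certified by the Frieze--Jerrum guarantee is strictly less than the random baseline: $$\alpha^{\mathrm{FJ}}_k\cdot\frac{\mathsf{OPT}_k(G)}{|E|} < \frac{k-1}{k}.$$
   Context: For a graph $G=(V,E)$ and an integer $k\ge 2$, $\mathsf{OPT}_k(G)=\max_{\chi:V\to\mathbb{Z}_k}\#\{\{u,v\}\in E:\chi(u)\ne\chi(v)\}$ is the Max-$k$-Cut value. The cut fraction of an assignment $\chi$ is the number of edges it cuts divided by $|E|$; a uniformly random assignment has expected cut fraction $(k-1)/k$, called the random baseline. $\lambda_{\min}(A_G)$ is the smallest eigenvalue of the adjacency matrix. The Frieze--Jerrum algorithm solves the semidefinite program: maximize $\frac{k-1}{k}\sum_{\{u,v\}\in E}(1-X_{uv})$ over $X\succeq 0$ indexed by $V$ with $X_{uu}=1$ and $X_{uv}\ge -\frac{1}{k-1}$ for $u\ne v$. It factors an optimal $X$ as a Gram matrix of unit vectors $\mathbf y_u$ ($u\in V$), samples $k$ independent random unit vectors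 $\mathbf g_1,\dots,\mathbf g_k$ in the embedding space, and assigns to each vertex $u$ the label $a$ maximizing $\mathbf y_u\cdot\mathbf g_a$. The Frieze--Jerrum approximation ratio $\alpha^{\mathrm{FJ}}_k$ is the worst-case approximation ratio of this algorithm, a constant depending only on $k$: on every graph $G$ the algorithm is guaranteed to cut (in expectation) at least $\alpha^{\mathrm{FJ}}_k\,\mathsf{OPT}_k(G)$ edges. The cut fraction certified by this guarantee is $\alpha^{\mathrm{FJ}}_k\,\mathsf{OPT}_k(G)/|E|$. *)

(* Defs.v *)
From HB Require Import structures.
From mathcomp Require Import all_boot all_order all_algebra.
From mathcomp Require Import all_classical all_reals all_analysis.
From mathcomp Require Import measurable_realfun.

Set Implicit Arguments.
Unset Strict Implicit.
Unset Printing Implicit Defensive.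

Import Order.TTheory GRing.Theory Num.Theory.
Import numFieldNormedType.Exports.

Local Open Scope ring_scope.

Record sgraph := SGraph {
  vertex :> finType;
  adj : rel vertex;
  adj_sym : symmetric adj;
  adj_irr : irreflexive adj }.

Arguments adj {_}.

(* The undirected edge {u, v} is represented by whichever of (u, v), (v, u) is
   increasing for the enumeration of the vertices, hence is counted once. *)
Definition edges (G : sgraph) : {set G * G} :=
  [set p : G * G | adj p.1 p.2 && (enum_rank p.1 < enum_rank p.2)%N].

Definition regular (G : sgraph) (d : nat) :=
  forall u : G, #|[set v : G | adj u v]| = d.

Definition cut (L : eqType) (G : sgraph) (chi : G -> L) : nat :=
  #|[set p in edges G | chi p.1 != chi p.2]|.

(* 'Z_k is the ring of integers modulo k for k >= 2 only. *)
Definition OPT (k : nat) (G : sgraph) : nat :=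
  (\max_(chi : {ffun G -> 'Z_k}) cut chi)%N.

Section Spectrum.
Variable R : realType.

Definition adj_mx (G : sgraph) : 'M[R]_#|G| :=
  \matrix_(i, j) (adj (enum_val i) (enum_val j))%:R.

(* For nonempty n the spectrum of a real symmetric matrix is finite and
   nonempty, so this infimum is the smallest eigenvalue. *)
Definition lambda_min (n : nat) (A : 'M[R]_n) : R :=
  inf [set a : R | eigenvalue A a]%classic.

End Spectrum.

Section SDP.
Variables (R : realType) (k : nat) (G : sgraph).

Definition psd (n : nat) (A : 'M[R]_n) :=
  A^T = A /\ forall x : 'rV[R]_n, 0 <= (x *m A *m x^T) 0 0.

Definition vx (X : 'M[R]_#|G|) (u v : G) : R := X (enum_rank u) (enum_rank v).

Definition sdp_value (X : 'M[R]_#|G|) : R :=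
  (k%:R - 1) / k%:R * \sum_(p in edges G) (1 - vx X p.1 p.2).

Definition sdp_feasible (X : 'M[R]_#|G|) :=
  [/\ psd X, forall u : G, vx X u u = 1
    & forall u v : G, u != v -> - (k%:R - 1)^-1 <= vx X u v].

Definition sdp_optimal (X : 'M[R]_#|G|) :=
  sdp_feasible X /\ forall X', sdp_feasible X' -> sdp_value X' <= sdp_value X.

End SDP.

Section IID.
Context d (T : measurableType d) (R : realType).
Variable P : probability T R.

Definition cons_tuple (n : nat) (p : T * n.-tuple T) : n.+1.-tuple T :=
  [tuple of p.1 :: p.2].

Lemma measurable_cons_tuple (n : nat) :
  measurable_fun [set: T * n.-tuple T]%classic (@cons_tuple n).
Proof. exact: measurable_cons. Qed.

HB.instance Definition _ (n : nat) :=
  isMeasurableFun.Build _ _ _ _ (@cons_tuple n) (@measurable_cons_tuple n).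

Fixpoint iid (n : nat) : probability (n.-tuple T) R :=
  match n with
  | 0 => dirac [tuple]
  | m.+1 => distribution (P \x iid m)%E (@cons_tuple m)
  end.

End IID.

Section UnitVector.
Variables (R : realType) (n : nat).

Definition dot (s t : n.-tuple R) : R := \sum_i tnth s i * tnth t i.

(* measurableTypeR R is R with the sigma-algebra that carries normal_prob. *)
Definition normalize (s : n.-tuple (measurableTypeR R)) : n.-tuple R :=
  [tuple tnth s i / Num.sqrt (dot s s) | i < n].

Lemma measurable_normalize :
  measurable_fun [set: n.-tuple (measurableTypeR R)]%classic normalize.
Proof.
have mtnth i : measurable_fun [set: n.-tuple (measurableTypeR R)]%classic
    ((fun s => tnth s i) : n.-tuple (measurableTypeR R) -> R).
  exact: (@measurable_tnth _ (measurableTypeR R) n i).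
apply/measurable_fun_tnthP => i.
rewrite [X in measurable_fun _ X](_ : _ =
    (fun s : n.-tuple R => tnth s i * (dot s s) `^ (- 2^-1))); last first.
  apply/funext => s /=; rewrite tnth_mktuple powRN powR12_sqrt//.
  by apply: sumr_ge0 => j _; rewrite -expr2 sqr_ge0.
apply: measurable_funM; first exact: mtnth.
apply: (measurableT_comp (measurable_powR _)).
by apply: measurable_sum => j; apply: measurable_funM; exact: mtnth.
Qed.

HB.instance Definition _ :=
  isMeasurableFun.Build _ _ _ _ normalize measurable_normalize.

(* By rotation invariance, a standard Gaussian vector of R^n scaled to norm 1
   is uniform on the unit sphere (n >= 1; the zero vector, which normalize
   leaves unchanged, has probability 0). *)
Definition uniform_sphere : probability (n.-tuple R) R :=
  distribution (iid (normal_prob 0 1) n) normalize.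

End UnitVector.

Section FriezeJerrum.
Variables (R : realType) (k : nat) (G : sgraph).

Definition gram (X : 'M[R]_#|G|) (y : G -> #|G|.-tuple R) :=
  forall u v : G, dot (y u) (y v) = vx X u v.

Notation directions := ((Zp_trunc k).+2.-tuple (#|G|.-tuple R)).

(* Directions are indexed by 'Z_k = 'I_(Zp_trunc k).+2.  When #|G| >= 2, ties
   have probability 0, so the way arg max breaks them is immaterial. *)
Definition fj_label (y : G -> #|G|.-tuple R) (g : directions) (u : G) : 'Z_k :=
  [arg max_(a > (0 : 'Z_k)) dot (y u) (tnth g a)]%O.

Definition fj_expected_cut (y : G -> #|G|.-tuple R) : R :=
  fine ('E_(iid (uniform_sphere R #|G|) (Zp_trunc k).+2)
          [fun g => (cut (fj_label y g))%:R])%E.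

End FriezeJerrum.

(* The algorithm does not specify which optimal solution and which Gram
   factorization it uses, so the worst case also ranges over these. *)
Definition alphaFJ (R : realType) (k : nat) : R :=
  inf [set r : R | exists (G : sgraph) (X : 'M[R]_#|G|)
                          (y : G -> #|G|.-tuple R),
    [/\ (0 < #|edges G|)%N, sdp_optimal k X, gram X y
      & r = fj_expected_cut k y / (OPT k G)%:R]]%classic.

Definition d_star (R : realType) (k : nat) : R :=
  4 * alphaFJ R k ^+ 2 / (1 - alphaFJ R k) ^+ 2.

(* Main.v *)
(* Hoffman-type bound.  The quadratic form of the symmetric matrix A_G is at
   least lambda_min times the squared norm; summing this over the centred
   indicator vectors of the k colour classes of a cut gives
     OPT_k / |E| <= (k-1)/k * (1 - lambda_min / d).
   With lambda_min >= -2 sqrt(d-1) > -2 sqrt d, the certified fraction is less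
   than the baseline as soon as alpha (1 + 2 / sqrt d) <= 1, and
   d > 4 alpha^2 / (1 - alpha)^2 is exactly the strict form of this. *)
Require Import Defs.
From mathcomp Require Import all_boot all_order all_algebra.
From mathcomp Require Import all_classical all_reals all_analysis.
From mathcomp Require Import complex polyrcf ring lra.
Import Order.TTheory GRing.Theory Num.Theory.
Local Open Scope ring_scope.

(** Over the complex numbers the spectral theorem gives a unitary diagonalization of [A]. In the
    coordinates [y] both forms become sums of the [|y_i|^2], with weights [m] and [D_i], and are
    compared term by term. *)
Lemma rayleigh_ge (R : rcfType) (n : nat) (A : 'M[R]_n) (m : R) (x : 'rV_n) :
  A^T = A -> (forall a, eigenvalue A a -> m <= a) ->
  m * (x *m x^T) 0 0 <= (x *m A *m x^T) 0 0.
Proof.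
move=> symA mA.
pose B := map_mx (real_complex R) A.
have realB : B \is a mxOver Num.real.
  by apply/mxOverP => i j; rewrite mxE; apply/complex_realP; exists (A i j).
have symB : B \is symmetricmx.
  by apply/is_hermitianmxP; rewrite expr0 scale1r map_mx_id// /B map_trmx symA.
have hermB := realsym_hermsym symB realB.
have /orthomx_spectralP := hermitian_normalmx hermB.
have /mxOverP real_sp := hermitian_spectral_diag_real hermB.
have := spectral_unitarymx B; have := spectral_unit B.
move: (spectralmx B) (spectral_diag B) real_sp => P D realD unitP unitaryP BE.
(* Row [i] of [P] is an eigenvector of [B] for [D 0 i]; as this value is real, it is already an
   eigenvalue of [A]. *)
have mD i : (real_complex R m <= D 0 i)%R.
  have /complex_realP[r Dr] := realD 0 i; rewrite Dr lecR; apply: mA.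
  suff : eigenvalue B (D 0 i) by rewrite Dr eigenvalue_map.
  apply/eigenvalueP; exists (row i P).
    rewrite BE -row_mul !mulmxA mulmxV// mul1mx.
    by apply/rowP => j; rewrite mul_diag_mx !mxE.
  have Pfree : row_free P by rewrite row_free_unit.
  apply: contraTneq Pfree => Pi0; apply/row_freePn; exists i.
  by rewrite Pi0 sub0mx.
pose z := map_mx (real_complex R) x; pose y := z *m invmx P.
have zT : map_mx (@Num.conj _) z^T = z^T.
  apply/matrixP => i j; rewrite !mxE.
  by apply/CrealP/complex_realP; exists (x j i).
(* [P] is unitary and [z] is real, so conjugate transposition turns [invmx P] back into [P]. *)
have yT : map_mx (@Num.conj _) y^T = P *m z^T.
  rewrite /y invmx_unitary// trmx_mul map_mxM zT; congr (_ *m _).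
  by apply/matrixP => i j; rewrite !mxE; exact: conjCK.
rewrite -lecR rmorphM/=.
have -> : real_complex R ((x *m x^T) 0 0) = \sum_i `|y 0 i| ^+ 2.
  transitivity ((z *m z^T) 0 0); first by rewrite /z map_trmx -map_mxM [RHS]mxE.
  have -> : z *m z^T = y *m map_mx (@Num.conj _) y^T.
    by rewrite yT /y mulmxA mulmxKV.
  by rewrite mxE; apply: eq_bigr => i _; rewrite !mxE normCK.
have -> : real_complex R ((x *m A *m x^T) 0 0) = \sum_i D 0 i * `|y 0 i| ^+ 2.
  transitivity ((z *m B *m z^T) 0 0).
    by rewrite /z map_trmx -!map_mxM [RHS]mxE.
  have -> : z *m B *m z^T = y *m diag_mx D *m map_mx (@Num.conj _) y^T.
    by rewrite yT BE /y !mulmxA.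
  rewrite mxE; apply: eq_bigr => i _.
  by rewrite mul_mx_diag !mxE normCK; ring.
rewrite mulr_sumr; apply: ler_sum => i _.
by rewrite ler_wpM2r// exprn_ge0.
Qed.

(** An infimum is a lower bound only of a set bounded below; the Cauchy bound on the roots of the
    characteristic polynomial ensures this. *)
Lemma lambda_min_le (R : realType) (n : nat) (A : 'M[R]_n) (a : R) :
  eigenvalue A a -> lambda_min A <= a.
Proof.
move=> Aa; apply: ge_inf => //; exists (- cauchy_bound (char_poly A)) => b /=.
rewrite eigenvalue_root_char => /rootP pb.
have := cauchy_boundP (monic_neq0 (char_poly_monic A)) pb.
by rewrite ltr_norml => /andP[/ltW].
Qed.

Lemma sum_enum_val (R : realType) (G : sgraph) (F : G -> R) :
  \sum_u F u = \sum_(i < #|G|) F (enum_val i).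
Proof. by rewrite (reindex (@enum_val G G))//; exact/onW_bij/enum_val_bij. Qed.

Lemma quad_form_adj (R : realType) (G : sgraph) (f : G -> R) :
  let x : 'rV[R]_#|G| := \row_i f (enum_val i) in
  (x *m adj_mx R G *m x^T) 0 0 = \sum_u \sum_v (adj u v)%:R * (f u * f v).
Proof.
move=> x; rewrite exchange_big /= sum_enum_val mxE; apply: eq_bigr => j _.
rewrite mxE big_distrl /= sum_enum_val; apply: eq_bigr => i _.
by rewrite !mxE; ring.
Qed.

Lemma norm_row_enum (R : realType) (G : sgraph) (f : G -> R) :
  let x : 'rV[R]_#|G| := \row_i f (enum_val i) in
  (x *m x^T) 0 0 = \sum_u f u * f u.
Proof.
by move=> x; rewrite sum_enum_val mxE; apply: eq_bigr => i _; rewrite !mxE.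
Qed.

(** The left side counts ordered pairs, while [edges] keeps one orientation of each edge: [swap]
    supplies the other, and irreflexivity makes the two ranks differ. *)
Lemma sum_adj_cut (G : sgraph) (L : eqType) (chi : G -> L) :
  (\sum_u \sum_v adj u v * (chi u != chi v) = 2 * Defs.cut chi)%N.
Proof.
pose S := [set p in edges G | chi p.1 != chi p.2].
pose swap (p : G * G) := (p.2, p.1).
have swapK : involutive swap by case.
pose T := [set p : G * G | adj p.1 p.2 && (chi p.1 != chi p.2)].
have TE : T = S :|: swap @: S.
  apply/finset.setP => -[u v]; rewrite finset.in_setU (can_imset_pre _ swapK) !inE /=.
  rewrite (adj_sym v u) (eq_sym (chi v)).
  rewrite -andb_orl -andb_orr; have [uv|//] := boolP (adj u v).
  rewrite -neq_ltn; have -> // : enum_rank u != enum_rank v :> nat.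
  by apply: contraTneq uv => /val_inj/enum_rank_inj ->; rewrite adj_irr.
have dis : [disjoint S & swap @: S].
  rewrite -finset.setI_eq0; apply/eqP/setP => -[u v].
  rewrite finset.in_setI (can_imset_pre _ swapK) !inE /=.
  by case: ltngtP; rewrite ?andbF.
have cT : #|T| = (2 * Defs.cut chi)%N.
  have := leq_card_setU S (swap @: S).
  rewrite -TE => -[_]; rewrite dis => /eqP ->.
  by rewrite card_imset ?addnn ?mul2n//; exact: inv_inj.
rewrite pair_big /= -cT -sum1_card [RHS]big_mkcond /=.
by apply: eq_bigr => -[u v] _; rewrite inE /=; case: (adj u v); case: (_ == _).
Qed.
Lemma sum_adj (G : sgraph) (d : nat) :
  regular G d -> (\sum_(u : G) \sum_(v : G) adj u v = #|G| * d)%N.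
Proof.
move=> regG; rewrite -sum_nat_const; apply: eq_bigr => u _.
rewrite -[RHS](regG u) -sum1dep_card [RHS]big_mkcond.
by apply: eq_bigr => v _; case: (adj u v).
Qed.

Lemma card_edges (G : sgraph) (d : nat) :
  regular G d -> (2 * #|edges G| = #|G| * d)%N.
Proof.
(* The injective colouring [enum_rank] cuts every edge, so the handshake identity is a case of
   [sum_adj_cut]. *)
move=> regG; pose e (u : G) := enum_rank u.
rewrite -(sum_adj _ _ regG); transitivity (2 * Defs.cut e)%N.
  congr (2 * _)%N; apply: eq_card => -[u v]; rewrite !inE /=.
  by have [/=|] := ltnP; rewrite ?andbF// -val_eqE/= neq_ltn => ->; rewrite !andbT.
rewrite -(sum_adj_cut _ _ e); apply: eq_bigr => u _; apply: eq_bigr => v _.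
rewrite (inj_eq enum_rank_inj).
by have [->|_] := eqVneq u v; rewrite ?adj_irr ?muln1.
Qed.

(* Testing the bottom of the spectrum against the centred indicator vectors
   [chi = a] - 1/#|L| of the colour classes. *)
Lemma cut_le_eigenvalue (R : realType) (G : sgraph) (L : finType) (d : nat)
    (chi : G -> L) (m : R) :
  regular G d -> (0 < #|L|)%N ->
  (forall a, eigenvalue (adj_mx R G) a -> m <= a) ->
  2 * (Defs.cut chi)%:R <= #|G|%:R * (1 - #|L|%:R^-1) * (d%:R - m).
Proof.
move=> regG L0 mA; set c := #|L|%:R^-1.
have L0R : #|L|%:R != 0 :> R by rewrite pnatr_eq0 -lt0n.
pose f (a : L) u : R := (chi u == a)%:R - c.
have sym : (adj_mx R G)^T = adj_mx R G.
  by apply/matrixP => i j; rewrite !mxE adj_sym.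
(* Summed over colours, the products depend only on whether [u] and [v] share a colour; [u = v]
   gives the squared norms, adjacent pairs the quadratic form. *)
have sumf u v : \sum_a f a u * f a v = (chi u == chi v)%:R - c.
  under eq_bigr do rewrite mulrBl !mulrBr.
  rewrite !sumrB -mulr_suml -mulr_sumr sumr_const.
  have sum1 w : \sum_a (chi w == a)%:R = 1 :> R.
    rewrite (bigD1 (chi w)) //= eqxx big1 ?addr0// => a.
    by rewrite eq_sym => /negPf ->.
  rewrite !sum1 (bigD1 (chi u)) //= eqxx big1 => [|a]; last first.
    by rewrite eq_sym => /negPf ->; rewrite mul0r.
  have -> : c * c *+ #|L| = c by rewrite -mulr_natr -mulrA mulVf// mulr1.
  by rewrite (eq_sym (chi v)) mulr1n; ring.
have := ler_sum (index_enum L) (P := predT)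
  (fun a _ => rayleigh_ge _ _ _ _ (\row_i f a (enum_val i)) sym mA).
under eq_bigr do rewrite norm_row_enum.
under [leRHS]eq_bigr do rewrite quad_form_adj.
rewrite -mulr_sumr exchange_big/= [leRHS]exchange_big /=.
under eq_bigr do rewrite sumf eqxx.
rewrite sumr_const -[_ *+ #|_|]mulr_natl mulr1n.
(* Each ordered adjacent pair contributes [1 - c], less 1 when it is cut. *)
have -> : \sum_u \sum_a \sum_v (adj u v)%:R * (f a u * f a v) =
    #|G|%:R * d%:R * (1 - c) - 2 * (Defs.cut chi)%:R.
  rewrite -!natrM -(sum_adj _ _ regG) -sum_adj_cut !natr_sum mulr_suml -sumrB.
  apply: eq_bigr => u _; rewrite exchange_big !natr_sum mulr_suml -sumrB /=.
  apply: eq_bigr => v _; rewrite -mulr_sumr sumf natrM.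
  by case: eqVneq => _ /=; ring.
by rewrite -[#|xpredT|]/#|G|; lra.
Qed.

Lemma OPT_le_lambda_min (R : realType) (k d : nat) (G : sgraph) :
  (1 < k)%N -> regular G d ->
  2 * (OPT k G)%:R <=
  #|G|%:R * (1 - k%:R^-1) * (d%:R - lambda_min (adj_mx R G)).
Proof.
move=> k1 regG; rewrite /OPT.
have [|chi ->] :=
  @bigop.eq_bigmax _ (fun chi : {ffun G -> 'Z_k} => Defs.cut chi).
  by apply/card_gt0P; exists [ffun=> 0].
have cardZ : #|'Z_k| = k by rewrite card_ord Zp_cast.
rewrite -[in k%:R]cardZ; apply: cut_le_eigenvalue => //.
  by rewrite cardZ ltnW.
exact: lambda_min_le.
Qed.

Lemma ratio_lt1 (R : realType) (alpha : R) (d : nat) :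
  0 < alpha < 1 -> 4 * alpha ^+ 2 / (1 - alpha) ^+ 2 < d%:R ->
  alpha * (d%:R + 2 * Num.sqrt (d%:R - 1)) < d%:R.
Proof.
move=> /andP[a0 a1] hd.
have b0 : 0 < 1 - alpha by lra.
have d0 : 0 <= d%:R :> R by [].
set s := Num.sqrt (d%:R : R).
have ss : s ^+ 2 = d%:R by rewrite sqr_sqrtr.
have s0 : 0 <= s by exact: sqrtr_ge0.
have s1 : Num.sqrt (d%:R - 1 : R) <= s by rewrite ler_sqrt// lerBlDr lerDl.
(* This is the square root of the hypothesis on [d]; multiplied by [s], it gives the claim with [s]
   in place of [Num.sqrt (d%:R - 1)]. *)
have sa : 2 * alpha < s * (1 - alpha).
  rewrite -(@ltr_pXn2r _ 2)// ?nnegrE; [|by lra|by rewrite mulr_ge0// ltW].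
  by rewrite !exprMn ss -ltr_pdivrMr ?exprn_gt0//; apply: le_lt_trans hd; lra.
have sp : 0 < s by rewrite -(pmulr_lgt0 _ b0); lra.
have := ler_wpM2l (ltW a0) s1.
have : s * (2 * alpha) < s * (s * (1 - alpha)) by rewrite ltr_pM2l.
by rewrite -ss; lra.
Qed.

Theorem proposition1 (R : realType) (k : nat) (hk : (2 <= k)%N)
    (halpha : 0 < alphaFJ R k < 1)
    (d : nat) (G : sgraph) (hreg : regular G d)
    (hlambda : - (2 * Num.sqrt (d%:R - 1)) <= lambda_min (adj_mx R G))
    (hd : d_star R k < d%:R) :
  alphaFJ R k * ((OPT k G)%:R / #|edges G|%:R) < (k%:R - 1) / k%:R.
Proof.
have ratio := ratio_lt1 _ _ _ halpha hd.
move: halpha ratio {hd} => /andP[]; move: (alphaFJ R k) => a a0 _ ratio.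
have k1 : 1 < k%:R :> R by rewrite ltr1n.
have k0 : k%:R != 0 :> R by rewrite pnatr_eq0 -lt0n ltnW.
have E : 2 * #|edges G|%:R = #|G|%:R * d%:R :> R.
  by rewrite -!natrM (card_edges _ _ hreg).
have -> : (k%:R - 1) / k%:R = 1 - k%:R^-1 :> R by field.
have kV : 0 < 1 - k%:R^-1 :> R by rewrite subr_gt0 invf_lt1// (lt_trans ltr01).
(* Without edges the quotient is 0 by the convention for division by 0. *)
have [->|E0] := posnP #|edges G|; first by rewrite invr0 mulr0 mulr0.
have n0 : 0 < #|G|%:R :> R.
  rewrite ltr0n lt0n; apply: contraTneq E0 => G0.
  have /eqP := card_edges _ _ hreg.
  by rewrite G0 mul0n muln_eq0 /= => /eqP ->.
have opt := OPT_le_lambda_min R _ _ _ hk hreg.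
(* Denominators are cleared and both sides doubled, so that [E] replaces the edge count; cancelling
   the positive factor [#|G| (1 - 1/k)] then leaves [ratio]. *)
rewrite mulrA ltr_pdivrMr ?ltr0n// -(ltr_pM2l (ltr0n R 2)) mulrCA [ltRHS]mulrCA E.
have bound : 2 * (OPT k G)%:R <=
    #|G|%:R * (1 - k%:R^-1) * (d%:R + 2 * Num.sqrt (d%:R - 1)) :> R.
  apply: le_trans opt _; apply: ler_wpM2l; last by lra.
  by rewrite mulr_ge0// ltW.
apply: le_lt_trans (ler_wpM2l (ltW a0) bound) _.
rewrite mulrCA [ltRHS]mulrA [X in _ < X * _]mulrC.
by rewrite ltr_pM2l ?mulr_gt0.
Qed.
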